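(* Let $p>3$ be a prime, let $a\in\mathbb{Z}_p$ with $a\not\equiv0\pmod p$, let $\langle a\rangle_p$ be the least nonnegative residue of $a$ modulo $p$, and let $t=(a-\langle a\rangle_p)/p$. Then $$\sum_{k=0}^{(p-1)/2}k\binom ak\binom{-1-a}k\equiv\begin{cases}(-1)^{\langle a\rangle_p}a(a+1)-\frac12pt\big(2a(a+1)E_{p-2}(-a)+2a+1\big)\pmod{p^2}&\text{if }\langle a\rangle_p\le\frac{p-1}2,\\ (-1)^{\langle a\rangle_p}a(a+1)-\frac12p(t+1)\big(2a(a+1)E_{p-2}(-a)+2a+1\big)\pmod{p^2}&\text{if }\langle a\rangle_p>\frac{p-1}2.\end{cases}$$
   Context: $\mathbb{Z}_p$ denotes the set of rational numbers whose denominator is not divisible by $p$; congruences modulo $p^m$ are taken in $\mathbb{Z}_p$. For $a\in\mathbb{Z}_p$, $\langle a\rangle_p\in\{0,1,\dots,p-1\}$ satisfies $\langle a\rangle_p\equiv a\pmod p$. $\binom xk=x(x-1)\cdots(x-k+1)/k!$. The Euler numbers are defined by $E_0=1$, $E_n=-\sum_{k=1}^{[n/2]}\binom n{2k}E_{n-2k}$ ($n\ge1$), and the Euler polynomials by $E_n(x)=2^{-n}\sum_{r=0}^n\binom nr(2x-1)^{n-r}E_r$. *)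

(* Defs.v *)
From mathcomp Require Import all_boot all_order all_algebra.

Set Implicit Arguments.
Unset Strict Implicit.
Unset Printing Implicit Defensive.

Import Order.TTheory GRing.Theory Num.Theory.
Local Open Scope ring_scope.

(* Membership in the ring Z_p of rationals with denominator prime to p; denq is
   the reduced denominator. *)
Definition p_integral (p : nat) (x : rat) : bool := ~~ (p %| `|denq x|)%N.

(* x - y lies in p ^ m Z_p. *)
Definition congr_mod (p m : nat) (x y : rat) : bool :=
  p_integral p ((x - y) / p%:R ^+ m).

(* The list is 0, 1, ..., p - 1, so [find] returns the first residue r with
   a = r modulo p, and the junk value p when there is none (a not in Z_p). *)
Definition residue (p : nat) (a : rat) : nat :=
  find (fun r : nat => congr_mod p 1 a r%:R) (iota 0 p).

Definition binom (x : rat) (k : nat) : rat :=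
  (\prod_(i < k) (x - i%:R)) / k`!%:R.

(* [euler_seq n] is [:: E_0; ...; E_(n-1)]. *)
Fixpoint euler_seq (n : nat) : seq rat :=
  if n is m.+1 then
    let s := euler_seq m in
    rcons s (if m == 0%N then 1
             else - \sum_(1 <= k < m./2.+1) 'C(m, k.*2)%:R * s`_(m - k.*2))
  else [::].

Definition euler (n : nat) : rat := (euler_seq n.+1)`_n.

Definition euler_poly (n : nat) : {poly rat} :=
  2%:R ^- n *: \sum_(0 <= r < n.+1)
    ('C(n, r)%:R * euler r) *: (2%:R *: 'X - 1) ^+ (n - r).

Lemma size_euler_seq n : size (euler_seq n) = n.
Proof. by elim: n => //= n IHn; rewrite size_rcons IHn. Qed.

Lemma nth_euler_seq n i : (i < n)%N -> (euler_seq n)`_i = euler i.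
Proof.
elim: n => // n IHn; rewrite ltnS leq_eqVlt => /orP[/eqP-> //|lt_in].
by rewrite /= nth_rcons size_euler_seq lt_in IHn.
Qed.

Lemma euler0 : euler 0 = 1.
Proof. by []. Qed.

Lemma eulerE n : (0 < n)%N ->
  euler n = - \sum_(1 <= k < n./2.+1) 'C(n, k.*2)%:R * euler (n - k.*2).
Proof.
move=> n_gt0; rewrite {1}/euler /= nth_rcons size_euler_seq ltnn eqxx.
rewrite -[n == 0%N]negbK -lt0n n_gt0 /=; congr (- _).
apply: eq_big_nat => k /andP[k_gt0 _]; rewrite nth_euler_seq //.
by rewrite ltn_subrL double_gt0 k_gt0.
Qed.

(* Main.v *)
Require Import Defs.
From mathcomp Require Import all_boot all_order all_algebra.
From mathcomp Require Import ring zify.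

Import Order.TTheory GRing.Theory Num.Theory.
Local Open Scope ring_scope.

(** Write n = (p-1)/2, a = r + p t with 0 <= r < p, and let T(a) be the sum of
binom a k * binom (-1-a) k over k <= n. Put g(a) = a * prod_(1 <= i <= n) (1 - a^2/i^2).
Telescoping in k gives the exact identities
  sum_(k <= n) k * binom a k * binom (-1-a) k = a(a+1) T(a) - (a+1+n) g(a),
  a (T(a) + T(a-1)) = 2 g(a),   g(a) (a-1-n) = g(a-1) (a+n).
Since a + n = (a-1-n) + p, the last one shows by induction on r <= n that
g(a) = p t mod p^2. The middle one then matches E_m(x) + E_m(x+1) = 2 x^m for
m = p-2, because x^(p-2) = 1/x mod p, so T(a) = (-1)^r - p t E_(p-2)(-a) mod p^2 by
induction on r; the case r = 0 amounts to E_(p-2)(0) = 1 + 1/2 + ... + 1/n mod p.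
Residues r > n follow from the symmetry a -> -1-a, which sends r to p-1-r and t
to -1-t. *)

(** * Arithmetic of p-integral rationals *)

(** [congr_mod p m x y] unfolds to [pdvd p m (x - y)], so every congruence is handled as
    divisibility of a difference. *)
Definition pdvd (p m : nat) (x : rat) : bool := p_integral p (x / p%:R ^+ m).

Section PadicIntegers.

Variable p : nat.
Hypothesis p_pr : prime p.

(** The reduced denominator divides every other denominator, so closure properties can be checked on
    unreduced fractions. *)
Lemma p_integral_frac (x : rat) (n d : int) :
  ~~ (p %| `|d|)%N -> x * d%:~R = n%:~R -> p_integral p x.
Proof.
move=> pNd xd; rewrite /p_integral; apply: contra pNd => /dvdn_trans; apply.
have e : numq x * d = n * denq x.
  by apply: (@intr_inj rat); rewrite !intrM -xd numqE mulrAC.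
have : (denq x %| numq x * d)%Z by rewrite e dvdz_mull.
by rewrite dvdzE abszM Gauss_dvdr // coprime_sym coprime_num_den.
Qed.

Lemma p_integralM (x y : rat) :
  p_integral p x -> p_integral p y -> p_integral p (x * y).
Proof.
move=> px py.
apply: (@p_integral_frac _ (numq x * numq y) (denq x * denq y)).
  by rewrite abszM Euclid_dvdM // negb_or; apply/andP.
by rewrite !intrM !numqE mulrACA.
Qed.

Lemma p_integralD (x y : rat) :
  p_integral p x -> p_integral p y -> p_integral p (x + y).
Proof.
move=> px py.
apply: (@p_integral_frac _ (numq x * denq y + numq y * denq x)
         (denq x * denq y)).
  by rewrite abszM Euclid_dvdM // negb_or; apply/andP.
by rewrite intrD !intrM !numqE; ring.
Qed.

Lemma p_integral_int (n : int) : p_integral p n%:~R.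
Proof.
apply: (@p_integral_frac _ n 1); last by rewrite mulr1.
by rewrite dvdn1 neq_ltn prime_gt1 ?orbT.
Qed.

Lemma p_integral_nat (n : nat) : p_integral p n%:R.
Proof. exact: (p_integral_int n). Qed.

Lemma p_integralN (x : rat) : p_integral p x -> p_integral p (- x).
Proof. by rewrite /p_integral denqN. Qed.

Lemma p_integralB (x y : rat) :
  p_integral p x -> p_integral p y -> p_integral p (x - y).
Proof. by move=> px py; apply: p_integralD => //; apply: p_integralN. Qed.

Lemma p_integralX (n : nat) (x : rat) : p_integral p x -> p_integral p (x ^+ n).
Proof.
move=> px; elim: n => [|n IHn]; first exact: (p_integral_nat 1).
by rewrite exprS p_integralM.
Qed.

Lemma pdvd0E (x : rat) : pdvd p 0 x = p_integral p x.
Proof. by rewrite /pdvd expr0 divr1. Qed.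

Lemma pdvdD (m : nat) (x y : rat) : pdvd p m x -> pdvd p m y -> pdvd p m (x + y).
Proof. by rewrite /pdvd mulrDl; apply: p_integralD. Qed.

Lemma pdvdM (m n : nat) (x y : rat) :
  pdvd p m x -> pdvd p n y -> pdvd p (m + n) (x * y).
Proof. by rewrite /pdvd exprD invfM mulrACA; apply: p_integralM. Qed.

Lemma pdvdMl (m : nat) (x y : rat) :
  p_integral p x -> pdvd p m y -> pdvd p m (x * y).
Proof. by rewrite -pdvd0E; apply: pdvdM. Qed.

Lemma pdvdMr (m : nat) (x y : rat) :
  pdvd p m x -> p_integral p y -> pdvd p m (x * y).
Proof. by move=> px py; rewrite mulrC; apply: pdvdMl. Qed.

Lemma pdvdN (m : nat) (x : rat) : pdvd p m x -> pdvd p m (- x).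
Proof. by rewrite /pdvd mulNr; apply: p_integralN. Qed.

Lemma pdvdB (m : nat) (x y : rat) : pdvd p m x -> pdvd p m y -> pdvd p m (x - y).
Proof. by move=> px py; apply: pdvdD => //; apply: pdvdN. Qed.

Lemma pdvd0 (m : nat) : pdvd p m 0.
Proof. by rewrite /pdvd mul0r; apply: (p_integral_nat 0). Qed.

Lemma pdvd_sum (m : nat) (I : eqType) (s : seq I) (F : I -> rat) :
  (forall i, i \in s -> pdvd p m (F i)) -> pdvd p m (\sum_(i <- s) F i).
Proof.
move=> dF; rewrite big_seq; elim/big_ind: _ => //; first exact: pdvd0.
by move=> x y; apply: pdvdD.
Qed.

Lemma p_integral_sum (I : eqType) (s : seq I) (F : I -> rat) :
  (forall i, i \in s -> p_integral p (F i)) -> p_integral p (\sum_(i <- s) F i).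
Proof.
by move=> intF; rewrite -pdvd0E; apply: pdvd_sum => i /intF; rewrite pdvd0E.
Qed.

Lemma natr_prime_neq0 : p%:R != 0 :> rat.
Proof. by rewrite pnatr_eq0 -lt0n prime_gt0. Qed.

Lemma pdvd1p : pdvd p 1 p%:R.
Proof.
by rewrite /pdvd expr1 divff ?natr_prime_neq0 //; apply: (p_integral_nat 1).
Qed.

Lemma pdvdW (m : nat) (x : rat) : pdvd p m.+1 x -> pdvd p m x.
Proof.
move=> px; have p0 := natr_prime_neq0.
rewrite /pdvd; have -> : x / p%:R ^+ m = p%:R * (x / p%:R ^+ m.+1).
  by rewrite exprS invfM mulrCA mulVKf.
by apply: p_integralM => //; apply: p_integral_nat.
Qed.

Lemma pdvd_nat (n : nat) : pdvd p 1 n%:R = (p %| n)%N.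
Proof.
have p0 := natr_prime_neq0; apply/idP/idP; last first.
  case/dvdnP=> q ->; rewrite natrM; apply: pdvdMl pdvd1p.
  exact: p_integral_nat.
rewrite /pdvd expr1 /p_integral => nd; set x := n%:R / p%:R in nd.
have e : n%:Z * denq x = numq x * p.
  apply: (@intr_inj rat); rewrite !intrM.
  have -> : p%:~R = p%:R :> rat by [].
  by rewrite numqE mulrAC divfK.
have : (p %| n%:Z * denq x)%Z by rewrite e dvdz_mull.
by rewrite dvdzE abszM /= Euclid_dvdM // (negPf nd) orbF.
Qed.

Lemma p_integralV (x : rat) :
  p_integral p x -> ~~ pdvd p 1 x -> p_integral p x^-1.
Proof.
move=> px pNx.
have dx0 : (denq x)%:~R != 0 :> rat by rewrite intr_eq0 denq_neq0.
have x0 : x != 0 by apply: contraNneq pNx => ->; apply: pdvd0.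
apply: (@p_integral_frac _ (denq x) (numq x)); last by rewrite numqE mulKf.
apply: contra pNx => pn; rewrite -[x]divq_num_den mulrC.
apply: pdvdMl.
  apply: (@p_integral_frac _ 1 (denq x)) => //; exact: mulVf.
move: pn; rewrite -/(dvdz p (numq x)) => /(@dvdzP p) [q ->].
by rewrite intrM; apply: pdvdMl; [exact: p_integral_int|exact: pdvd1p].
Qed.

Lemma p_integralVn (k : nat) : (0 < k < p)%N -> p_integral p (k%:R^-1).
Proof.
move=> /andP[k0 kp].
by rewrite p_integralV ?p_integral_nat // pdvd_nat gtnNdvd.
Qed.

Lemma pdvd_unit (m : nat) (x y : rat) :
  p_integral p x -> ~~ pdvd p 1 x -> pdvd p m (x * y) -> pdvd p m y.
Proof.
move=> px pNx; have x0 : x != 0 by apply: contraNneq pNx => ->; apply: pdvd0.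
by move/(pdvdMl _ _ _ (p_integralV _ px pNx)); rewrite mulKf.
Qed.

Lemma fermat_nat (d : nat) :
  ~~ (p %| d)%N -> pdvd p 1 (d%:R * d%:R ^+ (p - 2) - 1).
Proof.
move=> pNd; have d0 : (0 < d)%N by case: d pNd => //; rewrite dvdn0.
apply: (@pdvd_unit _ d%:R); rewrite ?p_integral_nat ?pdvd_nat //.
have p2 := prime_gt1 p_pr.
have -> : d%:R * (d%:R * d%:R ^+ (p - 2) - 1) = (d ^ p - d)%:R :> rat.
  rewrite natrB ?natrX; last by rewrite -{1}[d]expn1 leq_pexp2l // prime_gt0.
  by rewrite mulrBr mulr1 mulrA -expr2 -exprD subnKC.
rewrite pdvd_nat -eqn_mod_dvd ?fermat_little //.
by rewrite -{1}[d]expn1 leq_pexp2l // prime_gt0.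
Qed.

Lemma residueP (a : rat) : p_integral p a ->
  (residue p a < p)%N /\ pdvd p 1 (a - (residue p a)%:R).
Proof.
move=> pa; set P := (fun r : nat => congr_mod p 1 a r%:R).
have hasP : has P (iota 0 p).
  have [d dE] : exists d : nat, denq a = d.
    by exists `|denq a|%N; rewrite absz_denq.
  (* By Fermat, d ^ (p - 2) inverts the denominator d modulo p. *)
  pose z := numq a * (d ^ (p - 2))%:Z.
  have p0 : p%:Z != 0 by rewrite eqz_nat -lt0n prime_gt0.
  have [r rE] : exists r : nat, (z %% p)%Z = r.
    by exists `|(z %% p)%Z|%N; rewrite gez0_abs // modz_ge0.
  apply/hasP; exists r.
    by rewrite mem_iota /= add0n -ltz_nat -rE ltz_pmod // ltz_nat prime_gt0.
  rewrite /P /congr_mod -/(pdvd p 1 _).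
  (* Since [numq a] is a d, z equals a d d^(p-2). Hence a - r = (a - z) + (z - r), and z - r is a
     multiple of p. *)
  have -> : a - r%:R =
      - (a * (d%:R * d%:R ^+ (p - 2) - 1)) + (z %/ p)%Z%:~R * p%:R.
    have := congr1 (fun m : int => m%:~R : rat) (divz_eq z p).
    rewrite rE intrD /= !intrM numqE dE -!pmulrn natrX => e.
    by rewrite -[r%:R](addKr ((z %/ p)%Z%:~R * p%:R)) -e; ring.
  apply: pdvdD; last by apply: pdvdMl pdvd1p; exact: p_integral_int.
  apply: pdvdN; apply: pdvdMl => //; apply: fermat_nat.
  by move: pa; rewrite /p_integral dE.
have lt_p : (find P (iota 0 p) < p)%N.
  by rewrite -[X in (_ < X)%N](size_iota 0 p) -has_find.
by split => //; have := nth_find 0%N hasP; rewrite nth_iota // add0n.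
Qed.

Lemma pdvd_subX (m n : nat) (x y : rat) : p_integral p x -> p_integral p y ->
  pdvd p m (x - y) -> pdvd p m (x ^+ n - y ^+ n).
Proof.
move=> px py xy; rewrite subrXX; apply: pdvdMr => //.
rewrite -pdvd0E; apply: pdvd_sum => i _; rewrite pdvd0E.
by apply: p_integralM; apply: p_integralX.
Qed.

(** Fermat's theorem for naturals passes to a through its residue, so the power p - 2 acts as the
    inverse modulo p. *)
Lemma fermat_p_integral (a : rat) : p_integral p a -> ~~ pdvd p 1 a ->
  pdvd p 1 (a * a ^+ (p - 2) - 1).
Proof.
move=> pa pNa; have [_ ar] := residueP a pa; set r := residue p a in ar.
rewrite -exprS; have -> : a ^+ (p - 2).+1 - 1 =
  (a ^+ (p - 2).+1 - r%:R ^+ (p - 2).+1) + (r%:R * r%:R ^+ (p - 2) - 1).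
  by rewrite -exprS subrKA.
apply: pdvdD; first by apply: pdvd_subX => //; exact: p_integral_nat.
apply: fermat_nat; rewrite -pdvd_nat; apply: contra pNa => dr.
by rewrite -(subrK r%:R a); apply: pdvdD.
Qed.

End PadicIntegers.

(** * Euler polynomials *)

(** For odd n, every index n - 2k in the recurrence is odd and smaller than n. *)
Lemma euler_odd (n : nat) : odd n -> euler n = 0.
Proof.
elim/ltn_ind: n => n IHn odd_n; have n0 := odd_gt0 odd_n.
rewrite eulerE // big_nat_cond big1 ?oppr0 // => k.
rewrite andbT ltnS => /andP[k0 kn].
have le_kn : (k.*2 <= n)%N by rewrite -[n]odd_double_half; lia.
by rewrite IHn ?mulr0 ?ltn_subrL ?double_gt0 ?k0 // oddB // odd_double addbF.
Qed.

Lemma sum_euler (m : nat) : (0 < m)%N ->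
  \sum_(k < m./2.+1) 'C(m, k.*2)%:R * euler (m - k.*2) = 0.
Proof.
move=> m0; rewrite big_ord_recl /= bin0 mul1r subn0 [X in X + _]eulerE //.
rewrite big_add1 big_mkord /= addrC; apply/eqP; rewrite subr_eq0; apply/eqP.
by apply: eq_bigr.
Qed.

Lemma sum_even_terms (V : nmodType) (F : nat -> V) (m : nat) :
  (forall j, odd j -> F j = 0) -> \sum_(j < m.+1) F j = \sum_(k < m./2.+1) F k.*2.
Proof.
move=> F0; elim: m => [|m IHm]; first by rewrite !big_ord_recr !big_ord0.
rewrite big_ord_recr IHm /= uphalf_half.
case: (boolP (odd m)) => odd_m; last by rewrite F0 ?addr0 //= odd_m.
rewrite [RHS]big_ord_recr /=; congr (_ + F _).
by rewrite -[m in LHS]odd_double_half odd_m.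
Qed.

(** Coefficient form of E_n(x) + E_n(x+1) = 2 x^n: the last factor kills the terms with m - r odd
    and doubles the others, which leaves the recurrence. *)
Lemma sum_euler_binom (m : nat) :
  \sum_(r < m.+1) 'C(m, r)%:R * euler r * (1 + (-1) ^+ (m - r)) = 2%:R *+ (m == 0%N).
Proof.
rewrite (reindex_inj rev_ord_inj) /=.
under eq_bigr => i _ do rewrite subSS bin_sub -1?ltnS // subKn -1?ltnS //.
rewrite (@sum_even_terms _ (fun j => 'C(m, j)%:R * euler (m - j) * (1 + (-1) ^+ j))).
  under eq_bigr => i _ do rewrite -signr_odd odd_double.
  rewrite -mulr_suml; case: (posnP m) => [->|m0]; last first.
    by rewrite sum_euler // mul0r eqn0Ngt m0.
  by rewrite big_ord_recr big_ord0 /= euler0.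
by move=> j odd_j; rewrite -signr_odd odd_j subrr mulr0.
Qed.

(** Multiplied by r! (m-r)! (n-m)!, both sides become n!. *)
Lemma mul_bin_subset (n m r : nat) : (r <= m)%N -> (m <= n)%N ->
  ('C(n, r) * 'C(n - r, m - r) = 'C(n, m) * 'C(m, r))%N.
Proof.
move=> rm mn; have rn := leq_trans rm mn.
have mrn : (m - r <= n - r)%N by rewrite leq_sub2r.
apply/eqP; rewrite -(eqn_pmul2r (fact_gt0 r)) -(eqn_pmul2r (fact_gt0 (m - r))).
rewrite -(eqn_pmul2r (fact_gt0 (n - m))); apply/eqP.
have e1 := bin_fact rn; have e2 := bin_fact mrn.
have e3 := bin_fact mn; have e4 := bin_fact rm.
have e : (n - r - (m - r) = n - m)%N by lia.
rewrite e in e2; transitivity n`!; first by rewrite -e1 -e2; ring.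
by rewrite -e3 -e4; ring.
Qed.

Lemma horner_euler_poly (n : nat) (x : rat) :
  (euler_poly n).[x] =
    2%:R ^- n * \sum_(r < n.+1) 'C(n, r)%:R * euler r * (2%:R * x - 1) ^+ (n - r).
Proof.
rewrite /euler_poly hornerZ horner_sum big_mkord; congr (_ * _).
by apply: eq_bigr => i _; rewrite hornerZ horner_exp !hornerE.
Qed.

(** The substitution negates 2x - 1, and only even r contribute, so each surviving term gains the
    sign (-1)^(n-r) = (-1)^n. *)
Lemma euler_poly_reflect (n : nat) (x : rat) :
  (euler_poly n).[1 - x] = (-1) ^+ n * (euler_poly n).[x].
Proof.
rewrite !horner_euler_poly mulrCA; congr (_ * _); rewrite mulr_sumr.
apply: eq_bigr => -[r /= lt_rn] _.
have -> : 2%:R * (1 - x) - 1 = - (2%:R * x - 1) by ring.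
case: (boolP (odd r)) => [/euler_odd ->|ev_r]; first by rewrite !(mulr0, mul0r).
rewrite (exprNn (2%:R * x - 1)) mulrCA -(signr_odd _ (n - r)) oddB //.
by rewrite (negPf ev_r) addbF signr_odd.
Qed.

Lemma euler_poly_addS (n : nat) (x : rat) :
  (euler_poly n).[x] + (euler_poly n).[x + 1] = 2%:R * x ^+ n.
Proof.
rewrite !horner_euler_poly -mulrDr -big_split /=.
set y := 2%:R * x.
have two0 : 2%:R != 0 :> rat by [].
(* [H r m] is the contribution of E_r to the term in y^(n-m) once (y-1)^(n-r) + (y+1)^(n-r) is
   expanded. For fixed m, summing over r gives 0 unless m = 0. *)
pose H r m := y ^+ (n - m) * 'C(n, m)%:R *
  ('C(m, r)%:R * euler r * (1 + (-1) ^+ (m - r))).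
suff -> : \sum_(i < n.+1)
     ('C(n, i)%:R * euler i * (y - 1) ^+ (n - i) +
      'C(n, i)%:R * euler i * (2%:R * (x + 1) - 1) ^+ (n - i))
   = \sum_(m < n.+1) \sum_(r < m.+1) H r m.
  have Hm m : \sum_(r < m.+1) H r m =
      y ^+ (n - m) * 'C(n, m)%:R * (2%:R *+ (m == 0%N)).
    by rewrite -sum_euler_binom mulr_sumr.
  under eq_bigr => m _ do rewrite Hm.
  rewrite big_ord_recl big1 => [|i _]; last by rewrite mulr0.
  rewrite /= subn0 bin0 mulr1 addr0 /y exprMn mulr1n -[X in _ * X]mulrA.
  by rewrite mulKf ?expf_neq0 // mulrC.
transitivity (\sum_(i < n.+1) \sum_(m < n.+1 | (i <= m)%N) H i m); last first.
  rewrite (exchange_big_dep predT) //=. apply: eq_bigr => m _.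
  by rewrite (big_ord_widen _ (fun r => H r m) (ltn_ord m)); apply: eq_bigl.
apply: eq_bigr => -[r /= lt_rn] _.
have -> : 2%:R * (x + 1) - 1 = y + 1 by rewrite /y; ring.
rewrite -mulrDr addrC.
have -> : \sum_(m < n.+1 | (r <= m)%N) H r m = \sum_(0 + r <= m < n.+1) H r m.
  by rewrite (big_nat_widenl r 0) // big_mkord.
(* With m = j + r, the inner sum runs over the same j as the two binomial expansions. *)
rewrite big_addn subSn -1?ltnS // big_mkord exprDn exprBn -big_split.
rewrite mulr_sumr /=.
apply: eq_bigr => -[j /= lt_j] _; rewrite /H addnK.
have jn : (j + r <= n)%N by lia.
have e := mul_bin_subset n (j + r) r (leq_addl _ _) jn.
rewrite addnK in e; rewrite expr1n (_ : n - (j + r) = n - r - j)%N; last lia.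
have -> : y ^+ (n - r - j) * 'C(n, j + r)%:R *
    ('C(j + r, r)%:R * euler r * (1 + (-1) ^+ j)) =
  y ^+ (n - r - j) * ('C(n, j + r) * 'C(j + r, r))%:R * (euler r * (1 + (-1) ^+ j)).
  by rewrite natrM; ring.
by rewrite -e natrM -mulrnDl -[_ *+ 'C(n - r, j)]mulr_natr; ring.
Qed.

(** * Binomial identities *)

Definition binom2 (a : rat) (k : nat) : rat := binom a k * binom (- 1 - a) k.

(* Equals a * prod_(1 <= i <= k) (1 - a^2 / i^2). *)
Definition oddprod (a : rat) (k : nat) : rat :=
  a * binom (a - 1) k * binom (- a - 1) k.

Lemma binom0 (x : rat) : binom x 0 = 1.
Proof. by rewrite /binom big_ord0 divr1. Qed.

Lemma binomS (x : rat) (k : nat) : binom x k.+1 = binom x k * (x - k%:R) / k.+1%:R.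
Proof.
rewrite /binom big_ord_recr /= factS natrM.
have f0 : k`!%:R != 0 :> rat by rewrite pnatr_eq0 -lt0n fact_gt0.
by field; rewrite f0 ?nat1r pnatr_eq0.
Qed.

Lemma binom2_0 (a : rat) : binom2 a 0 = 1.
Proof. by rewrite /binom2 !binom0 mulr1. Qed.

Lemma binom2S (a : rat) (k : nat) :
  binom2 a k.+1 = - (binom2 a k * (a - k%:R) * (a + k.+1%:R) / k.+1%:R ^+ 2).
Proof. by rewrite /binom2 !binomS; field; rewrite nat1r pnatr_eq0. Qed.

Lemma oddprod0 (a : rat) : oddprod a 0 = a.
Proof. by rewrite /oddprod !binom0 !mulr1. Qed.

Lemma oddprodS (a : rat) (k : nat) :
  oddprod a k.+1 = oddprod a k - oddprod a k * (a ^+ 2 / k.+1%:R ^+ 2).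
Proof. by rewrite /oddprod !binomS; field; rewrite nat1r pnatr_eq0. Qed.

(** Passing from k to k + 1 multiplies both sides by 1 - a^2/(k+1)^2. *)
Lemma binom2_oddprod (a : rat) (k : nat) : binom2 a k * (a - k%:R) = oddprod a k.
Proof.
elim: k => [|k IHk]; first by rewrite binom2_0 oddprod0 subr0 mul1r.
by rewrite binom2S oddprodS -IHk; field; rewrite nat1r pnatr_eq0.
Qed.

Lemma binom2_oddprod_pred (a : rat) (k : nat) :
  binom2 (a - 1) k * (a + k%:R) = oddprod a k.
Proof.
elim: k => [|k IHk]; first by rewrite binom2_0 oddprod0 addr0 mul1r.
by rewrite binom2S oddprodS -IHk; field; rewrite nat1r pnatr_eq0.
Qed.

Lemma oddprod_shift (a : rat) (k : nat) :
  oddprod a k * (a - 1 - k%:R) = oddprod (a - 1) k * (a + k%:R).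
Proof.
elim: k => [|k IHk]; first by rewrite !oddprod0; ring.
(* The new factor 1 - a^2/(k+1)^2 contains a - (k+1) = a - 1 - k, which is what the induction
   hypothesis needs. *)
have -> : oddprod a k.+1 * (a - 1 - k.+1%:R) = - (oddprod a k * (a - 1 - k%:R))
    * (a + k.+1%:R) * (a - 1 - k.+1%:R) / k.+1%:R ^+ 2.
  by rewrite oddprodS; field; rewrite nat1r pnatr_eq0.
by rewrite IHk oddprodS; field; rewrite nat1r pnatr_eq0.
Qed.

(** Telescoping: from n = k - 1 to n = k, (a+1+n) [oddprod a n] grows by (a(a+1) - k)
    [binom2 a k]. *)
Lemma sum_mul_binom2 (a : rat) (n : nat) :
  \sum_(0 <= k < n.+1) k%:R * binom2 a k =
  a * (a + 1) * \sum_(0 <= k < n.+1) binom2 a k - (a + 1 + n%:R) * oddprod a n.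
Proof.
elim: n => [|n IHn]; first by rewrite !big_nat1 binom2_0 oddprod0; ring.
rewrite !(@big_nat_recr _ _ _ n.+1) //= IHn -!binom2_oddprod binom2S.
by field; rewrite nat1r pnatr_eq0.
Qed.

(** The two terms of index n + 1 carry the factors a + n + 1 and a - 1 - n, whose sum 2a yields
    twice the increment of [oddprod a]. *)
Lemma sum_binom2_pred (a : rat) (n : nat) :
  a * (\sum_(0 <= k < n.+1) binom2 a k + \sum_(0 <= k < n.+1) binom2 (a - 1) k) =
  2%:R * oddprod a n.
Proof.
elim: n => [|n IHn]; first by rewrite !big_nat1 !binom2_0 oddprod0; ring.
rewrite !(@big_nat_recr _ _ _ n.+1) //= addrACA mulrDr IHn.
have -> : binom2 a n.+1 = - (oddprod a n * (a + n.+1%:R) / n.+1%:R ^+ 2).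
  by rewrite binom2S binom2_oddprod.
have -> : binom2 (a - 1) n.+1 = - (oddprod a n * (a - 1 - n%:R) / n.+1%:R ^+ 2).
  by rewrite binom2S -binom2_oddprod_pred; field; rewrite nat1r pnatr_eq0.
by rewrite oddprodS; field; rewrite nat1r pnatr_eq0.
Qed.

Lemma binom2_sym (a : rat) (k : nat) : binom2 (- 1 - a) k = binom2 a k.
Proof. by rewrite /binom2 mulrC; congr (binom _ _ * _); ring. Qed.

(** The alternating sum is twice its even terms minus the full sum, and 2/(2i) = 1/i. Sums may start
    at 0 because the inverse of 0 is 0 here. *)
Lemma sum_alt_harmonic (n : nat) :
  \sum_(0 <= j < n.*2.+1) (-1) ^+ j / j%:R =
  \sum_(0 <= j < n.+1) j%:R^-1 - \sum_(0 <= j < n.*2.+1) j%:R^-1 :> rat.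
Proof.
elim: n => [|n IHn]; first by rewrite !big_nat1 invr0 mulr0 subrr.
rewrite doubleS !(@big_nat_recr _ _ _ n.*2.+2) // !(@big_nat_recr _ _ _ n.*2.+1) //=.
rewrite IHn (@big_nat_recr _ _ _ n.+1) //=.
have -> : (-1) ^+ n.*2.+1 = -1 :> rat by rewrite -signr_odd /= odd_double.
have -> : (-1) ^+ n.*2.+2 = 1 :> rat by rewrite -signr_odd /= odd_double.
have -> : n.*2.+2%:R = 2%:R * n.+1%:R :> rat by rewrite -doubleS -mul2n natrM.
set A := \sum_(_ <= _ < n.+1) _; set B := \sum_(_ <= _ < n.*2.+1) _.
set x := n.*2.+1%:R^-1; by rewrite invfM; field; rewrite nat1r pnatr_eq0.
Qed.

(** * Congruences modulo p and p^2 *)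

Section Congruences.

Variables (p n : nat).
Hypotheses (p_pr : prime p) (p_odd : p = n.*2.+1).

Let intg_nat k := p_integral_nat p p_pr k.
Let intgM x y := p_integralM p p_pr x y.
Let intgD x y := p_integralD p p_pr x y.

Lemma oddprod_pdvd (a : rat) (k : nat) : (k < p)%N -> pdvd p 1 a ->
  pdvd p 2 (oddprod a k - a).
Proof.
move=> + pa; elim: k => [|k IHk] lt_kp.
  by rewrite oddprod0 subrr; apply: pdvd0.
have {}IHk := IHk (ltnW lt_kp).
have int_k : p_integral p (k.+1%:R^-1 ^+ 2).
  by apply: p_integralX => //; apply: p_integralVn; rewrite ?lt_kp.
rewrite oddprodS addrAC; apply: pdvdB => //.
apply: (@pdvdM p p_pr 1 1); last first.
  rewrite expr2 -exprVn; apply: pdvdMr => //; apply: pdvdMr => //.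
  by rewrite -pdvd0E; apply: pdvdW.
by rewrite -[oddprod a k](subrK a); apply: pdvdD => //; apply: pdvdW.
Qed.

(** For 0 < k < p, [binom2 a k] is -g (a+k)/k^2 with g = [oddprod a (k - 1)], and g is a mod p^2; as
    p divides a, this is -a/k mod p^2. *)
Lemma sum_binom2_pdvd (a : rat) (m : nat) : (m < p)%N -> pdvd p 1 a ->
  pdvd p 2 (\sum_(0 <= k < m.+1) binom2 a k -
            (1 - a * \sum_(0 <= j < m.+1) j%:R^-1)).
Proof.
move=> + pa; elim: m => [|m IHm] lt_mp.
  by rewrite !big_nat1 binom2_0 invr0 mulr0 subr0 subrr; apply: pdvd0.
have {}IHm := IHm (ltnW lt_mp).
have int_m : p_integral p m.+1%:R^-1 by apply: p_integralVn; rewrite ?lt_mp.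
have int_a : p_integral p a by rewrite -pdvd0E; apply: pdvdW.
rewrite !(@big_nat_recr _ _ _ m.+1) //=.
set S := \sum_(_ <= _ < _) _ in IHm *; set H := \sum_(_ <= _ < _) _ in IHm *.
have -> : S + binom2 a m.+1 - (1 - a * (H + m.+1%:R^-1)) =
    (S - (1 - a * H)) - (oddprod a m - a) * ((a + m.+1%:R) * m.+1%:R^-1 ^+ 2)
    - a * (a * m.+1%:R^-1 ^+ 2).
  by rewrite binom2S binom2_oddprod; field; rewrite nat1r pnatr_eq0.
apply: pdvdB => //; last first.
  by apply: (@pdvdM p p_pr 1 1) => //; apply: pdvdMr => //; apply: p_integralX.
apply: pdvdB => //; apply: pdvdMr => //; first by apply: oddprod_pdvd => //; apply: ltnW.
by apply: intgM; [apply: intgD|apply: p_integralX].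
Qed.

Lemma two_unit : ~~ pdvd p 1 2%:R.
Proof.
rewrite pdvd_nat // dvdn_prime2 // p_odd; apply/negP=> /eqP e.
by have := congr1 odd e; rewrite /= odd_double.
Qed.

Lemma pdvd_half (m : nat) (x : rat) : pdvd p m (2%:R * x) -> pdvd p m x.
Proof. by apply: pdvd_unit; rewrite ?two_unit. Qed.

(** In the doubled sum, j pairs with p - j, and 1/j + 1/(p-j) = p/(j(p-j)). The zero term at j = 0
    is split off first. *)
Lemma harmonic_pdvd : pdvd p 1 (\sum_(0 <= j < p) j%:R^-1).
Proof.
apply: pdvd_half; rewrite big_ltn ?prime_gt0 // invr0 add0r.
rewrite mulrDl mul1r {2}big_nat_rev -big_split /=.
apply: pdvd_sum => // j; rewrite mem_index_iota => /andP[j0 jp].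
rewrite add1n subSS natrB; last exact: ltnW.
have j0' : j%:R != 0 :> rat by rewrite pnatr_eq0 -lt0n.
have pj0 : p%:R - j%:R != 0 :> rat by rewrite -natrB 1?ltnW // pnatr_eq0 subn_eq0 -ltnNge.
have -> : j%:R^-1 + (p%:R - j%:R)^-1 = p%:R * (j%:R^-1 * (p%:R - j%:R)^-1) :> rat.
  by field; apply/andP.
apply: pdvdMr => //; first exact: pdvd1p.
apply: intgM; first by apply: p_integralVn => //; rewrite j0.
rewrite -natrB 1?ltnW //; apply: p_integralVn => //.
by rewrite subn_gt0 jp ltn_subrL j0 prime_gt0.
Qed.

Lemma p_integral_euler (m : nat) : p_integral p (euler m).
Proof.
elim/ltn_ind: m => m IHm; case: (posnP m) => [->|m0]; first exact: (intg_nat 1).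
rewrite eulerE //; apply: p_integralN; apply: p_integral_sum => // k.
rewrite mem_index_iota => /andP[k0 _].
by apply: intgM => //; apply: IHm; rewrite ltn_subrL double_gt0 k0.
Qed.

Lemma p_integral_expV2 (m : nat) : p_integral p (2%:R ^- m).
Proof.
rewrite -exprVn; apply: p_integralX => //.
by apply: p_integralV; rewrite ?two_unit.
Qed.

(** Euler numbers are p-integral and the only denominators are powers of 2, a unit for odd p. *)
Lemma euler_poly_congr (k m : nat) (x y : rat) : p_integral p x -> p_integral p y ->
  pdvd p k (x - y) -> pdvd p k ((euler_poly m).[x] - (euler_poly m).[y]).
Proof.
move=> px py xy; rewrite !horner_euler_poly -mulrBr.
apply: pdvdMl => //; first exact: p_integral_expV2.
rewrite -sumrB; apply: pdvd_sum => // i _; rewrite -mulrBr.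
apply: pdvdMl => //; first exact: intgM (p_integral_euler _).
have int1 := intg_nat 1.
apply: pdvd_subX => //; try by apply: p_integralB => //; exact: intgM.
have -> : 2%:R * x - 1 - (2%:R * y - 1) = 2%:R * (x - y) by ring.
exact: pdvdMl.
Qed.

(** Iterates E_N(x+1) = 2 x^N - E_N(x) from x = 0. *)
Lemma euler_poly_nat (N m : nat) : (euler_poly N).[m%:R] =
  (-1) ^+ m * ((euler_poly N).[0] - 2%:R * \sum_(0 <= j < m) (-1) ^+ j * j%:R ^+ N).
Proof.
elim: m => [|m IHm]; first by rewrite big_nil mulr0 subr0 mul1r.
have := euler_poly_addS N m%:R; rewrite natr1 => /(canRL (addKr _)) ->.
rewrite IHm big_nat_recr //= exprS.
set A := \sum_(_ <= _ < _) _; set E := (_).[_]; move: (m%:R ^+ N) => x.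
have : (-1) ^+ m * (-1) ^+ m = 1 :> rat by rewrite -expr2 sqrr_sign.
move: ((-1) ^+ m) => s ss1; have -> : 2%:R * x = 2%:R * (s * s) * x.
  by rewrite ss1 mulr1.
by ring.
Qed.

(** At m = p, [euler_poly_nat] reads E(p) = 2S - E(0); as E(p) and E(0) agree mod p, E(0) is S.
    Replacing j^(p-2) by 1/j turns S into an alternating harmonic sum, whose full harmonic part
    vanishes mod p. *)
Lemma euler_poly_0_pdvd :
  pdvd p 1 ((euler_poly (p - 2)).[0] - \sum_(0 <= j < n.+1) j%:R^-1).
Proof.
set E := (_).[0]; pose S := \sum_(0 <= j < p) (-1) ^+ j * j%:R ^+ (p - 2) : rat.
have E_S : pdvd p 1 (E - S).
  apply: pdvd_half; have := euler_poly_nat (p - 2) p; rewrite -/E -/S.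
  have -> : (-1) ^+ p = -1 :> rat by rewrite -signr_odd p_odd /= odd_double.
  move=> e; have -> : 2%:R * (E - S) = - ((euler_poly (p - 2)).[p%:R] - E).
    by rewrite e; ring.
  apply: pdvdN => //; apply: euler_poly_congr => //; first exact: (intg_nat 0).
  by rewrite subr0; apply: pdvd1p.
have := sum_alt_harmonic n; rewrite -p_odd.
set H := \sum_(_ <= _ < n.+1) _; set alt := (X in X = _) => altE.
have {altE} -> : E - H = (E - S) + ((S - alt) - \sum_(0 <= j < p) j%:R^-1).
  by rewrite altE; ring.
apply: pdvdD => //.
apply: pdvdB => //; last exact: harmonic_pdvd.
rewrite -sumrB; apply: pdvd_sum => // j; rewrite mem_index_iota => /andP[_ jp].
rewrite -mulrBr; apply: pdvdMl => //.
  by apply: p_integralX => //; apply: p_integralN; exact: (intg_nat 1).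
(* At j = 0 both 0^(p-2) and the inverse of 0 are 0, since p - 2 > 0. *)
case: (posnP j) => [->|j0].
  have p2 : (p - 2 == 0)%N = false by have := prime_gt1 p_pr; lia.
  by rewrite invr0 subr0 expr0n p2; apply: pdvd0.
have pNj : ~~ pdvd p 1 j%:R by rewrite pdvd_nat // gtnNdvd.
apply: (pdvd_unit _ p_pr _ j%:R) => //.
rewrite mulrBr mulfV ?pnatr_eq0 -?lt0n //.
exact: fermat_p_integral.
Qed.

Lemma natr_p_odd : p%:R = 2%:R * n%:R + 1 :> rat.
Proof. by rewrite p_odd -natr1 -mul2n natrM. Qed.

Lemma p_integral_residue_form (r : nat) (t : rat) :
  p_integral p t -> p_integral p (r%:R + p%:R * t).
Proof. by move=> pt; apply: intgD; last exact: intgM. Qed.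

Lemma oddprod_residue (r : nat) (t : rat) : (r <= n)%N -> p_integral p t ->
  pdvd p 2 (oddprod (r%:R + p%:R * t) n - p%:R * t).
Proof.
move=> + pt; have p_pt : pdvd p 1 (p%:R * t) by apply: pdvdMr => //; exact: pdvd1p.
elim: r => [|r IHr] le_rn.
  by rewrite add0r; apply: oddprod_pdvd => //; rewrite p_odd ltnS -addnn leq_addr.
have {}IHr := IHr (ltnW le_rn); set a := r.+1%:R + p%:R * t.
have aE : a - 1 = r%:R + p%:R * t by rewrite /a; ring.
have shift := oddprod_shift a n; rewrite aE -/a in shift.
(* The divisor a - 1 - n is r - n mod p, a unit because r < n; this confines the induction to
   residues at most n. *)
have unit_aN : ~~ pdvd p 1 (r%:R + p%:R * t - n%:R).
  apply/negP=> p_aN; have : pdvd p 1 (n - r)%:R.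
    rewrite natrB 1?ltnW //.
    have -> : n%:R - r%:R = p%:R * t - (r%:R + p%:R * t - n%:R) by ring.
    exact: pdvdB.
  rewrite pdvd_nat // gtnNdvd ?subn_gt0 // p_odd ltnS -addnn.
  by rewrite (leq_trans (leq_subr _ _)) ?leq_addr.
have int_a := p_integral_residue_form r.+1 t pt.
apply: (pdvd_unit _ p_pr _ (r%:R + p%:R * t - n%:R)) => //.
  by apply: p_integralB => //; apply: p_integral_residue_form.
(* Here a + n exceeds a - 1 - n by p, and the excess only multiplies p t, so it vanishes mod p^2. *)
have -> : (r%:R + p%:R * t - n%:R) * (oddprod a n - p%:R * t) =
    (oddprod (r%:R + p%:R * t) n - p%:R * t) * (a + n%:R) + p%:R * t * p%:R.
  rewrite mulrBr [_ * oddprod a n]mulrC shift /a natr_p_odd.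
  by ring.
apply: pdvdD => //; last by apply: (@pdvdM p p_pr 1 1) => //; apply: pdvd1p.
by apply: pdvdMr => //; apply: intgD.
Qed.

Lemma sum_binom2_residue (r : nat) (t : rat) : (r <= n)%N -> p_integral p t ->
  pdvd p 2 (\sum_(0 <= k < n.+1) binom2 (r%:R + p%:R * t) k -
    ((-1) ^+ r - p%:R * t * (euler_poly (p - 2)).[- (r%:R + p%:R * t)])).
Proof.
move=> + pt; have p_pt : pdvd p 1 (p%:R * t) by apply: pdvdMr => //; exact: pdvd1p.
have int_form := p_integral_residue_form _ t pt.
elim: r => [|r IHr] le_rn.
  rewrite add0r expr0; set E := _.[_]; set T := \sum_(_ <= _ < _) _.
  pose H : rat := \sum_(0 <= j < n.+1) j%:R^-1.
  (* The factor p t reduces the exchange of H for E_(p-2)(-p t) to a congruence mod p, made through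
     E_(p-2)(0). *)
  have -> : T - (1 - p%:R * t * E) = (T - (1 - p%:R * t * H)) +
      p%:R * t * ((E - (euler_poly (p - 2)).[0]) + ((euler_poly (p - 2)).[0] - H)).
    by ring.
  apply: pdvdD => //.
    by apply: sum_binom2_pdvd => //; rewrite p_odd ltnS -addnn leq_addr.
  apply: (@pdvdM p p_pr 1 1) => //; apply: pdvdD => //; last exact: euler_poly_0_pdvd.
  apply: euler_poly_congr; rewrite ?subr0 //; last exact: pdvdN.
    by apply: p_integralN; apply: intgM.
  exact: (intg_nat 0).
have {}IHr := IHr (ltnW le_rn); set a := r.+1%:R + p%:R * t.
have aE : r%:R + p%:R * t = a - 1 by rewrite /a; ring.
have g_a := oddprod_residue r.+1 t le_rn pt; rewrite -/a in g_a.
have int_a : p_integral p a by exact: int_form.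
have unit_a : ~~ pdvd p 1 a.
  apply/negP=> p_a; have : pdvd p 1 (r.+1)%:R.
    by rewrite -[r.+1%:R](addrK (p%:R * t)); apply: pdvdB.
  by rewrite pdvd_nat // gtnNdvd // p_odd ltnS -addnn (leq_trans le_rn) ?leq_addr.
rewrite aE in IHr; apply: (pdvd_unit _ p_pr _ a) => //.
have sum_a := sum_binom2_pred a n.
have eul : (euler_poly (p - 2)).[- (a - 1)] =
    2%:R * (- a) ^+ (p - 2) - (euler_poly (p - 2)).[- a].
  have -> : - (a - 1) = - a + 1 by ring.
  by rewrite -euler_poly_addS [RHS]addrAC subrr add0r.
rewrite eul in IHr; move: sum_a IHr.
set T := \sum_(_ <= _ < _) _; set T' := \sum_(_ <= _ < _) _; set E := _.[_].
move=> sum_a IHr; set s := (-1) ^+ r in IHr.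
(* Three errors divisible by p^2: the value of [oddprod a n], the induction hypothesis at a - 1, and
   Fermat for -a weighted by p t. The unit a is then cancelled. *)
have -> : a * (T - ((-1) ^+ r.+1 - p%:R * t * E)) =
    2%:R * (oddprod a n - p%:R * t)
    - a * (T' - (s - p%:R * t * (2%:R * (- a) ^+ (p - 2) - E)))
    - p%:R * t * (2%:R * ((- a) * (- a) ^+ (p - 2) - 1)).
  have -> : T = 2%:R * oddprod a n / a - T'.
    rewrite -sum_a mulrAC mulfV ?mul1r ?addrK //.
    by apply: contraNneq unit_a => ->; apply: pdvd0.
  rewrite exprS -/s; field.
  by apply: contraNneq unit_a => ->; apply: pdvd0.
have int_Na : p_integral p (- a) by apply: p_integralN.
apply: pdvdB => //.
  by apply: pdvdB => //; apply: pdvdMl.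
apply: (@pdvdM p p_pr 1 1) => //; apply: pdvdMl => //.
apply: fermat_p_integral => //.
by apply: contra unit_a => /(pdvdN p); rewrite opprK.
Qed.

Lemma sum_mul_binom2_residue (r : nat) (t a : rat) :
  (r <= n)%N -> p_integral p t -> a = r%:R + p%:R * t ->
  pdvd p 2 (\sum_(0 <= k < n.+1) k%:R * binom2 a k -
    ((-1) ^+ r * a * (a + 1) - 2%:R^-1 * p%:R * t *
      (2%:R * a * (a + 1) * (euler_poly (p - 2)).[- a] + 2%:R * a + 1))).
Proof.
move=> le_rn pt aE; have g_a := oddprod_residue r t le_rn pt.
have T_a := sum_binom2_residue r t le_rn pt; rewrite -aE in g_a T_a.
have int_a : p_integral p a by rewrite aE; exact: p_integral_residue_form.
have int1 := intg_nat 1.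
rewrite sum_mul_binom2; move: T_a; set T := \sum_(_ <= _ < _) _; set E := _.[_] => T_a.
(* Since n = (p-1)/2, a + 1 + n is (2a+1)/2 + p/2; the first part gives the term 2a + 1, the second
   the remainder p^2 t/2. *)
have -> : a * (a + 1) * T - (a + 1 + n%:R) * oddprod a n - ((-1) ^+ r * a * (a + 1) -
    2%:R^-1 * p%:R * t * (2%:R * a * (a + 1) * E + 2%:R * a + 1)) =
  a * (a + 1) * (T - ((-1) ^+ r - p%:R * t * E))
  - (a + 1 + n%:R) * (oddprod a n - p%:R * t)
  - p%:R * (p%:R * (t * 2%:R ^- 1)).
  have -> : n%:R = 2%:R^-1 * (p%:R - 1) :> rat.
    by rewrite natr_p_odd; field.
  by field.
have p_p := pdvd1p p p_pr.
apply: pdvdB => //; last first.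
  apply: (@pdvdM p p_pr 1 1) => //; apply: pdvdMr => //; apply: intgM => //.
  exact: (p_integral_expV2 1).
apply: pdvdB => //; apply: pdvdMl => //; last by apply: intgD => //; apply: intgD.
by apply: intgM => //; apply: intgD.
Qed.

End Congruences.

Theorem theorem3p4 (p : nat) (a : rat) :
  prime p -> (3 < p)%N -> p_integral p a -> ~~ congr_mod p 1 a 0 ->
  let r := residue p a in
  let t := (a - r%:R) / p%:R in
  congr_mod p 2
    (\sum_(0 <= k < (p.-1)./2.+1) k%:R * binom a k * binom (- 1 - a) k)
    (if (r <= (p.-1)./2)%N then
       (-1) ^+ r * a * (a + 1)
       - 2%:R^-1 * p%:R * t
         * (2%:R * a * (a + 1) * (euler_poly (p - 2)).[- a] + 2%:R * a + 1)
     else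
       (-1) ^+ r * a * (a + 1)
       - 2%:R^-1 * p%:R * (t + 1)
         * (2%:R * a * (a + 1) * (euler_poly (p - 2)).[- a] + 2%:R * a + 1)).
Proof.
move=> p_pr p_gt3 pa _; cbv zeta; set r := residue p a.
set t := (a - r%:R) / p%:R; have [r_lt_p p_ar] := residueP p p_pr a pa.
rewrite -/r in r_lt_p p_ar; rewrite /congr_mod -/(pdvd p 2 _).
have pt : p_integral p t by move: p_ar; rewrite /pdvd expr1.
set n := (p.-1)./2.
have p_odd : p = n.*2.+1.
  have odd_p : odd p by case: (even_prime p_pr) => // p2; move: p_gt3; rewrite p2.
  by rewrite /n halfK; case: (p) odd_p => //= m; lia.
have p0 : p%:R != 0 :> rat by exact: natr_prime_neq0.
have aE : a = r%:R + p%:R * t by rewrite /t mulrC divfK // addrC subrK.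
rewrite (eq_bigr (fun k => k%:R * binom2 a k)) => [|k _]; last by rewrite -mulrA.
case: leqP => [le_rn|lt_nr]; first exact: sum_mul_binom2_residue.
(* The case already proved is applied to -1 - a, with residue p - 1 - r and quotient -1 - t. *)
have le_r'n : (p.-1 - r <= n)%N by rewrite p_odd /= in r_lt_p *; lia.
have pt' : p_integral p (- 1 - t).
  by apply: p_integralB => //; apply: p_integralN; apply: (p_integral_nat p p_pr 1).
have r_le : (r <= p.-1)%N by rewrite -ltnS prednK ?prime_gt0.
have symE : - 1 - a = (p.-1 - r)%:R + p%:R * (- 1 - t).
  by rewrite aE natrB // -subn1 natrB ?prime_gt0 //; ring.
have := sum_mul_binom2_residue p n p_pr p_odd _ _ _ le_r'n pt' symE.
rewrite (eq_bigr _ (fun k _ => congr1 ( *%R k%:R) (binom2_sym a k))).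
have -> : (-1) ^+ (p.-1 - r) = (-1) ^+ r :> rat.
  by rewrite -signr_odd oddB // p_odd /= odd_double /= signr_odd.
(* Reflection gives E_(p-2)(1+a) = -E_(p-2)(-a). Since 2a + 1 also changes sign while a(a+1) does
   not, the bracket is negated, and this cancels the sign in -1 - t = -(t+1). *)
have -> : - (- 1 - a) = 1 - - a by ring.
rewrite euler_poly_reflect.
have -> : (-1) ^+ (p - 2) = -1 :> rat.
  by rewrite -signr_odd oddB ?prime_gt1 // {1}p_odd /= odd_double.
by congr (pdvd _ _ (_ - _)); ring.
Qed.
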